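(* Let $\mathbb{K}$ be a field of characteristic zero and let $\mathcal{W}(2)$ be the conservative algebra of $2$-dimensional algebras over $\mathbb{K}$. Then a map $\delta:\mathcal{W}(2)\times\mathcal{W}(2)\to\mathcal{W}(2)$ is a biderivation of $\mathcal{W}(2)$ if and only if $\delta$ is the zero mapping; that is, the space $\mathrm{BDer}(\mathcal{W}(2))$ of all biderivations of $\mathcal{W}(2)$ is $\{0\}$.
   Context: Algebras are vector spaces over $\mathbb{K}$ with a bilinear multiplication; they need not be associative, commutative or unital. The algebra $\mathcal{W}(2)$ (Kantor's algebra of all bilinear multiplications on a $2$-dimensional space) is the $8$-dimensional algebra over $\mathbb{K}$ with basis $e_1,\dots,e_8$ and the following multiplication (left factor first; all products of basis elements not listed are $0$): $e_1e_1=-e_1$, $e_1e_4=e_4$, $e_1e_5=-2e_5$, $e_1e_6=-e_6$, $e_1e_7=-e_7$; $e_2e_1=-e_2-e_3$, $e_2e_2=-e_4$, $e_2e_3=-e_4$, $e_2e_5=e_1-e_6-e_7$, $e_2e_6=e_2-e_8$, $e_2e_7=e_3-e_8$, $e_2e_8=e_4$; $e_5e_1=e_5$, $e_5e_2=-e_1+e_6$, $e_5e_3=-e_1+e_7$, $e_5e_4=-e_2-e_3+e_8$, $e_5e_6=-e_5$, $e_5e_7=-e_5$, $e_5e_8=-e_6-e_7$; $e_6e_2=-e_2$, $e_6e_3=-e_3$, $e_6e_4=-2e_4$, $e_6e_5=e_5$, $e_6e_8=-e_8$. A bilinear map $\delta:\mathcal{A}\times\mathcal{A}\to\mathcal{A}$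 on an algebra $\mathcal{A}$ is a biderivation if $\delta(xy,z)=x\,\delta(y,z)+\delta(x,z)\,y$ and $\delta(x,yz)=y\,\delta(x,z)+\delta(x,y)\,z$ for all $x,y,z\in\mathcal{A}$. *)

(* Defs.v *)
From HB Require Import structures.
From mathcomp Require Import all_boot all_algebra.
From mathcomp Require Import boolp classical_sets.

Set Implicit Arguments.
Unset Strict Implicit.
Unset Printing Implicit Defensive.

Import GRing.Theory.
Local Open Scope ring_scope.

(* An algebra over K is a K-module A together with a bilinear multiplication
   mul; associativity, commutativity and a unit are not assumed, hence mul is
   explicit instead of coming from a library ring structure on A. *)
Definition is_biderivation (K : fieldType) (A : lmodType K)
    (mul : {bilinear A -> A -> A}) (delta : A -> A -> A) : Prop :=
  [/\ bilinear_for *:%R *:%R delta,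
      forall x y z : A,
        delta (mul x y) z = mul x (delta y z) + mul (delta x z) y
    & forall x y z : A,
        delta x (mul y z) = mul y (delta x z) + mul (delta x y) z].

Definition BDer (K : fieldType) (A : lmodType K)
    (mul : {bilinear A -> A -> A}) : set (A -> A -> A) :=
  [set delta | is_biderivation mul delta]%classic.

Section KantorAlgebra.
Variable K : fieldType.

Definition W2 : lmodType K := 'rV[K]_8.

(* The basis vectors are numbered from 1: only W2_e 1, ..., W2_e 8 are meant,
   and W2_e k is the row vector with a 1 at (0-based) position k - 1. *)
Definition W2_e (k : nat) : W2 := delta_mx 0 (inord k.-1).
Local Notation e := W2_e.

Definition W2_table (i j : nat) : W2 :=
  match i, j with
  | 1%N, 1%N => - e 1
  | 1%N, 4%N => e 4
  | 1%N, 5%N => - (e 5 *+ 2)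
  | 1%N, 6%N => - e 6
  | 1%N, 7%N => - e 7
  | 2%N, 1%N => - e 2 - e 3
  | 2%N, 2%N => - e 4
  | 2%N, 3%N => - e 4
  | 2%N, 5%N => e 1 - e 6 - e 7
  | 2%N, 6%N => e 2 - e 8
  | 2%N, 7%N => e 3 - e 8
  | 2%N, 8%N => e 4
  | 5%N, 1%N => e 5
  | 5%N, 2%N => - e 1 + e 6
  | 5%N, 3%N => - e 1 + e 7
  | 5%N, 4%N => - e 2 - e 3 + e 8
  | 5%N, 6%N => - e 5
  | 5%N, 7%N => - e 5
  | 5%N, 8%N => - e 6 - e 7
  | 6%N, 2%N => - e 2
  | 6%N, 3%N => - e 3
  | 6%N, 4%N => - (e 4 *+ 2)
  | 6%N, 5%N => e 5
  | 6%N, 8%N => - e 8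
  | _, _ => 0
  end.

Definition W2_mul (x y : W2) : W2 :=
  \sum_(i < 8) \sum_(j < 8)
    (x 0 i * y 0 j) *: W2_table i.+1 j.+1.

Lemma W2_mul_is_bilinear : bilinear_for *:%R *:%R W2_mul.
Proof.
split=> [y|x] a u v; rewrite /= /W2_mul scaler_sumr -big_split /=;
  apply: eq_bigr => i _; rewrite scaler_sumr -big_split /=;
  apply: eq_bigr => j _; rewrite !mxE scalerA -scalerDl.
- by rewrite mulrDl mulrA.
- by rewrite mulrDr mulrCA.
Qed.

HB.instance Definition _ :=
  bilinear_isBilinear.Build K W2 W2 W2 *:%R *:%R W2_mul W2_mul_is_bilinear.

Lemma W2_mul_basis (i j : nat) : (0 < i <= 8)%N -> (0 < j <= 8)%N ->
  W2_mul (W2_e i) (W2_e j) = W2_table i j.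
Proof.
case: i => // i /= li; case: j => // j /= lj.
rewrite /W2_mul (bigD1 (inord i)) //= (bigD1 (inord j)) //= !mxE !eqxx mulr1.
rewrite scale1r !inordK // big1 => [|k /negPf nk]; last first.
  by rewrite !mxE nk andbF mulr0 scale0r.
rewrite big1 ?addr0 // => k /negPf nk; apply: big1 => l _.
by rewrite !mxE nk andbF mul0r scale0r.
Qed.

End KantorAlgebra.

(* Main.v *)
Require Import Defs.
From HB Require Import structures.
From mathcomp Require Import all_boot all_algebra ring.
From mathcomp Require Import boolp classical_sets.
Import GRing.Theory.
Local Open Scope ring_scope.

(** For x fixed, a biderivation delta gives a derivation delta(x, -) of the
    algebra, and for z fixed a derivation delta(-, z). So the theorem is a
    question about how few derivations W(2) has.

    Solving the Leibniz equations coordinatewise shows that every derivation D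
    agrees on e1, e2 and e5 with left multiplication by an element
    w = a e2 - b e6 of the plane spanned by e2 and e6
    ([derivation_on_generators]). Since e1, e2 and e5 generate the algebra, D
    is determined by (a, b) ([generators_determine_derivation]). The two values
      w e2 = b e2 - a e4   and   w e5 = a (e1 - e6 - e7) - b e5
    carry all the information that is needed:
    - each of them determines a and b, so a derivation that kills e2, or that
      kills e5, is zero ([derivation_eq0_of_e2], [derivation_eq0_of_e5]);
    - they lie in planes that meet only in 0, so no derivation takes at e2 a
      nonzero value that some derivation takes at e5
      ([derivations_meet_trivially]).

    Now delta(e5, e2) is both the value at e2 of the derivation delta(e5, -)
    and the value at e5 of the derivation delta(-, e2), hence is 0. Therefore
    delta(e5, -) kills e2 and is zero; therefore every delta(-, z) kills e5 and
    is zero as well. *)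

(** Coordinates are numbered from 1, in agreement with the basis e1, ..., e8. *)
Definition coord {K : fieldType} (k : nat) (x : W2 K) : K := x 0 (inord k.-1).

Local Notation "x @_ i" := (coord i x)
  (at level 2, i at level 1, format "x @_ i").

Lemma coordD (K : fieldType) k (x y : W2 K) :
  coord k (x + y) = coord k x + coord k y.
Proof. by rewrite /coord mxE. Qed.

Lemma coordN (K : fieldType) k (x : W2 K) : coord k (- x) = - coord k x.
Proof. by rewrite /coord mxE. Qed.

Lemma coordZ (K : fieldType) k (a : K) (x : W2 K) :
  coord k (a *: x) = a * coord k x.
Proof. by rewrite /coord mxE. Qed.

Lemma coord0 (K : fieldType) k : coord k (0 : W2 K) = 0.
Proof. by rewrite /coord mxE. Qed.

Lemma coord_e (K : fieldType) (k i : nat) :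
  (0 < k <= 8)%N -> (0 < i <= 8)%N -> coord k (W2_e K i) = (k == i)%:R.
Proof.
case: k => // k /= lk; case: i => // i /= li.
by rewrite /coord /W2_e mxE eqxx /= -val_eqE /= !inordK.
Qed.

Lemma coord_ext (K : fieldType) (x y : W2 K) :
  (forall k, (0 < k <= 8)%N -> coord k x = coord k y) -> x = y.
Proof.
move=> xy; apply/rowP=> i; have := xy i.+1 (ltn_ord i).
by rewrite /coord /= inord_val.
Qed.

Lemma W2_basis_expansion (K : fieldType) (x : W2 K) :
  x = \sum_(i < 8) x 0 i *: W2_e K i.+1.
Proof.
rewrite [LHS]row_sum_delta; apply: eq_bigr => i _.
by rewrite /W2_e /= inord_val.
Qed.

(** The multiplication table read by output coordinate. It turns the Leibniz
    identity for a linear map into scalar linear equations, which rewriting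
    and [ring] can handle. *)
Lemma W2_mulE (K : fieldType) (x y : W2 K) :
  (coord 1 (W2_mul x y) =
     - x@_1 * y@_1 + x@_2 * y@_5 - x@_5 * y@_2 - x@_5 * y@_3) *
  (coord 2 (W2_mul x y) =
     - x@_2 * y@_1 + x@_2 * y@_6 - x@_5 * y@_4 - x@_6 * y@_2) *
  (coord 3 (W2_mul x y) =
     - x@_2 * y@_1 + x@_2 * y@_7 - x@_5 * y@_4 - x@_6 * y@_3) *
  (coord 4 (W2_mul x y) =
     x@_1 * y@_4 - x@_2 * y@_2 - x@_2 * y@_3 + x@_2 * y@_8 - 2 * x@_6 * y@_4) *
  (coord 5 (W2_mul x y) =
     - 2 * x@_1 * y@_5 + x@_5 * y@_1 - x@_5 * y@_6 - x@_5 * y@_7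
     + x@_6 * y@_5) *
  (coord 6 (W2_mul x y) =
     - x@_1 * y@_6 - x@_2 * y@_5 + x@_5 * y@_2 - x@_5 * y@_8) *
  (coord 7 (W2_mul x y) =
     - x@_1 * y@_7 - x@_2 * y@_5 + x@_5 * y@_3 - x@_5 * y@_8) *
  (coord 8 (W2_mul x y) =
     - x@_2 * y@_6 - x@_2 * y@_7 + x@_5 * y@_4 - x@_6 * y@_8).
Proof.
have mul_coord k : coord k (W2_mul x y) = \sum_(i < 8) \sum_(j < 8)
    (coord i.+1 x * coord j.+1 y) * coord k (W2_table K i.+1 j.+1).
  rewrite /coord /W2_mul summxE; apply: eq_bigr => i _.
  by rewrite summxE; apply: eq_bigr => j _; rewrite mxE !inord_val.
have expand_sum (F : nat -> K) : \sum_(i < 8) F i =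
    F 0%N + F 1%N + F 2%N + F 3%N + F 4%N + F 5%N + F 6%N + F 7%N.
  by rewrite !big_ord_recr big_ord0 /= add0r.
do ![split]; rewrite mul_coord.
all: rewrite (expand_sum (fun i => \sum_(j < 8) coord i.+1 x * coord j.+1 y *
                                   coord _ (W2_table K i.+1 j.+1))).
all: rewrite !(expand_sum (fun j => coord _ x * coord j.+1 y *
                                   coord _ (W2_table K _ j.+1))) /=.
all: rewrite ?mulr2n !(coordD, coordN, coord0) !coord_e //=.
all: ring.
Qed.

Definition leibniz {K : fieldType} (D : W2 K -> W2 K) : Prop :=
  forall x y, D (W2_mul x y) = W2_mul x (D y) + W2_mul (D x) y.

(** The way the characteristic enters: the Leibniz equations often give an
    unknown only up to an integer factor, equal to 2 or 3 in some cases. *)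
Lemma eq_of_multiple (K : fieldType) (n : nat) (a b l r : K) :
  [pchar K] =i pred0 -> (0 < n)%N ->
  l = r -> l - r = n%:R * (a - b) -> a = b.
Proof.
move=> charK0 n_gt0 -> /esym/eqP; rewrite subrr mulf_eq0 subr_eq0.
by rewrite (pcharf0P K).1 // -leqn0 leqNgt n_gt0 => /eqP.
Qed.

Ltac expand :=
  rewrite /= ?mulr2n ?(linear0, linearD, linearB, linearN) /=
    ?(coordD, coordN, coordZ, coord0, W2_mulE) ?coord_e //=.

(** The ratio between the two linear equations is n or - n; an equation is
    symmetric, so both signs are tried. *)
Ltac from_equation charK0 n :=
  let E := fresh in
  move/(@eq_of_multiple _ n _ _ _ _ charK0 isT) => E;
  first [apply: E; ring | symmetry; apply: E; ring].

Section Derivation.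
Variables (K : fieldType) (D : {linear W2 K -> W2 K}).
Hypotheses (charK0 : [pchar K] =i pred0) (D_leibniz : leibniz D).
Local Notation e := (W2_e K).

Lemma leibniz_table (k i j : nat) : (0 < i <= 8)%N -> (0 < j <= 8)%N ->
  coord k (D (W2_table K i j)) =
  coord k (W2_mul (e i) (D (e j))) + coord k (W2_mul (D (e i)) (e j)).
Proof. by move=> li lj; rewrite -W2_mul_basis // D_leibniz coordD. Qed.

Ltac entry k i j := have := @leibniz_table k i j isT isT; expand.

(** The 64 unknown coordinates of D are linked by 512 linear equations; the
    short list used here is ordered so that each one yields a coordinate in
    terms of those that are still free. The element -e1 is idempotent and the
    left multiplication by e1 is diagonal, so the equations of e1 e1 = -e1, e1
    e5 = -2 e5, e5 e1 = e5 and e1 e2 = 0 settle most coordinates of D e1, D e5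
    and D e2. What remains comes from e7: the products e7 e1, e7 e5 and e5 e7
    show that D e7 has no component along e1, e5, e6 and e7, and comparing this
    with e7 = - (e2 e5 + e5 e2) determines the rest of D e1 and D e2. *)
Lemma derivation_on_generators : exists a b : K,
  let w := a *: e 2 - b *: e 6 in
  [/\ D (e 1) = W2_mul w (e 1), D (e 2) = W2_mul w (e 2)
    & D (e 5) = W2_mul w (e 5)].
Proof.
(* The letters a, p, q, r stand for D (e 1), D (e 2), D (e 5), D (e 7). *)
have a1 : (D (e 1))@_1 = 0 by entry 1%N 1%N 1%N; from_equation charK0 1%N.
have a3 : (D (e 1))@_3 = (D (e 1))@_2
  by entry 3%N 1%N 1%N; from_equation charK0 1%N.
have a4 : (D (e 1))@_4 = 0 by entry 4%N 1%N 1%N; from_equation charK0 2%N.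
have a8 : (D (e 1))@_8 = 0 by entry 8%N 1%N 1%N; from_equation charK0 1%N.
have a6 : (D (e 1))@_6 = 0
  by entry 5%N 1%N 5%N; rewrite ?a1; from_equation charK0 1%N.
have q1 : (D (e 5))@_1 = - (D (e 1))@_2
  by entry 1%N 1%N 5%N; from_equation charK0 1%N.
have q2 : (D (e 5))@_2 = 0 by entry 2%N 1%N 5%N; from_equation charK0 2%N.
have q3 : (D (e 5))@_3 = 0 by entry 3%N 1%N 5%N; from_equation charK0 2%N.
have q4 : (D (e 5))@_4 = 0 by entry 4%N 1%N 5%N; from_equation charK0 3%N.
have q6 : (D (e 5))@_6 = (D (e 1))@_2
  by entry 6%N 1%N 5%N; from_equation charK0 1%N.
have q7 : (D (e 5))@_7 = (D (e 1))@_2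
  by entry 7%N 1%N 5%N; from_equation charK0 1%N.
have q8 : (D (e 5))@_8 = 0 by entry 8%N 1%N 5%N; from_equation charK0 2%N.
have q := (q1, q2, q3, q4, q6, q7, q8).
have a7 : (D (e 1))@_7 = 0
  by entry 5%N 5%N 1%N; rewrite ?(q, a1, a6); from_equation charK0 1%N.
have p1 : (D (e 2))@_1 = - (D (e 1))@_5
  by entry 1%N 1%N 2%N; from_equation charK0 1%N.
have p4 : (D (e 2))@_4 = (D (e 1))@_2
  by entry 4%N 1%N 2%N; from_equation charK0 1%N.
have p5 : (D (e 2))@_5 = 0 by entry 5%N 1%N 2%N; from_equation charK0 2%N.
have p6 : (D (e 2))@_6 = (D (e 1))@_5
  by entry 6%N 1%N 2%N; from_equation charK0 1%N.
have p7 : (D (e 2))@_7 = 0 by entry 7%N 1%N 2%N; from_equation charK0 1%N.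
have r1 : (D (e 7))@_1 = 0 by entry 1%N 7%N 1%N; from_equation charK0 1%N.
have r5 : (D (e 7))@_5 = 0 by entry 5%N 7%N 1%N; from_equation charK0 1%N.
have r6 : (D (e 7))@_6 = 0
  by entry 5%N 7%N 5%N; rewrite ?r1; from_equation charK0 1%N.
have r7 : (D (e 7))@_7 = 0
  by entry 5%N 5%N 7%N; rewrite ?(r1, r6, q); from_equation charK0 1%N.
have e7E : - e 7 = W2_mul (e 2) (e 5) + W2_mul (e 5) (e 2).
  rewrite !W2_mul_basis //= [- e 1 + _]addrC -[e 6 - e 1]opprB.
  by rewrite addrAC subrr add0r.
have e7_entry k : - (D (e 7))@_k =
    coord k (W2_mul (e 2) (D (e 5)) + W2_mul (D (e 2)) (e 5)
           + (W2_mul (e 5) (D (e 2)) + W2_mul (D (e 5)) (e 2))).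
  by rewrite -!D_leibniz -linearD -e7E linearN coordN.
have p3 : (D (e 2))@_3 = 0.
  by have := e7_entry 1%N; expand;
    rewrite ?(r1, q, (p1, p4, p5, p6, p7)); from_equation charK0 1%N.
have a5 : (D (e 1))@_5 = 0.
  by have := e7_entry 5%N; expand;
    rewrite ?(r5, q, (p1, p4, p5, p6, p7)); from_equation charK0 1%N.
have p8 : (D (e 2))@_8 = 0.
  by have := e7_entry 6%N; expand;
    rewrite ?(r6, q, (p1, p4, p5, p6, p7)); from_equation charK0 1%N.
have p2 : (D (e 2))@_2 = - (D (e 5))@_5.
  by have := e7_entry 7%N; expand;
    rewrite ?(r7, q, (p1, p3, p4, p5, p6, p7, p8));
    from_equation charK0 1%N.
(* Read off w e1 = - a (e2 + e3) and the coordinate - b of w e5 along e5. *)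
exists (- (D (e 1))@_2), (- (D (e 5))@_5).
split; apply: coord_ext; do 9?[case=> //] => _.
all: expand.
all: rewrite ?(a1, a3, a4, a6, a7, a8, q, (p1, p2, p3, p4, p5, p6, p7, p8)).
all: rewrite ?a5; ring.
Qed.

(** The kernel of a derivation is a subalgebra, and the other basis vectors are
    reached from e1, e2, e5 through e2 e2, e5 e2, e2 e5, e2 e1 and e2 e6, in
    this order. The vector e1 is not redundant: e2 and e5 alone generate a
    proper subalgebra, of dimension 6. *)
Lemma generators_determine_derivation :
  D (e 1) = 0 -> D (e 2) = 0 -> D (e 5) = 0 -> forall x, D x = 0.
Proof.
move=> D1 D2 D5.
have D_table i j : (0 < i <= 8)%N -> (0 < j <= 8)%N ->
    D (e i) = 0 -> D (e j) = 0 -> D (W2_table K i j) = 0.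
  move=> li lj Di Dj; rewrite -W2_mul_basis // D_leibniz Di Dj.
  by rewrite (linear0r (@W2_mul K)) (linear0l (@W2_mul K)) addr0.
have D_opp v : D (- v) = 0 -> D v = 0.
  by rewrite linearN => /eqP; rewrite oppr_eq0 => /eqP.
have D4 : D (e 4) = 0 by apply: D_opp; exact: (D_table 2 2).
have D6 : D (e 6) = 0.
  by have := D_table 5 2 isT isT D5 D2; rewrite linearD linearN D1 oppr0 add0r.
have D7 : D (e 7) = 0.
  apply: D_opp; have := D_table 2 5 isT isT D2 D5.
  by rewrite /= linearD linearB D1 D6 subrr add0r.
have D3 : D (e 3) = 0.
  apply: D_opp; have := D_table 2 1 isT isT D2 D1.
  by rewrite /= linearD linearN D2 oppr0 add0r.
have D8 : D (e 8) = 0.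
  apply: D_opp; have := D_table 2 6 isT isT D2 D6.
  by rewrite /= linearD D2 add0r.
move=> x; rewrite (W2_basis_expansion _ x) linear_sum big1 // => i _.
rewrite linearZ /=; suff -> : D (e i.+1) = 0 by rewrite scaler0.
by case: i; do 8?[case=> //].
Qed.

(** Both parameters of the derivation can be read off its value at e2, in the
    coordinates 4 and 2. *)
Lemma derivation_eq0_of_e2 : D (e 2) = 0 -> forall x, D x = 0.
Proof.
have [a [b /= [D1 D2 D5]]] := derivation_on_generators; rewrite D2 => w2.
have a0 : a = 0.
  by have := congr1 (coord 4) w2; expand; from_equation charK0 1%N.
have b0 : b = 0.
  by have := congr1 (coord 2) w2; expand; from_equation charK0 1%N.
move: D1 D2 D5; rewrite a0 b0 !scale0r subrr !(linear0l (@W2_mul K)).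
exact: generators_determine_derivation.
Qed.

(** Both parameters of the derivation can be read off its value at e5, in the
    coordinates 1 and 5. *)
Lemma derivation_eq0_of_e5 : D (e 5) = 0 -> forall x, D x = 0.
Proof.
have [a [b /= [D1 D2 D5]]] := derivation_on_generators; rewrite D5 => w5.
have a0 : a = 0.
  by have := congr1 (coord 1) w5; expand; from_equation charK0 1%N.
have b0 : b = 0.
  by have := congr1 (coord 5) w5; expand; from_equation charK0 1%N.
move: D1 D2 D5; rewrite a0 b0 !scale0r subrr !(linear0l (@W2_mul K)).
exact: generators_determine_derivation.
Qed.

End Derivation.

(** The coordinates 1 and 5 vanish on the values at e2, and on the values at e5
    they are, up to sign, the two parameters of the derivation. *)
Lemma derivations_meet_trivially (K : fieldType)
    (D D' : {linear W2 K -> W2 K}) :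
  [pchar K] =i pred0 -> leibniz D -> leibniz D' ->
  D (W2_e K 2) = D' (W2_e K 5) -> D (W2_e K 2) = 0.
Proof.
move=> charK0 DL D'L meet.
have [a [b /= [_ D2 _]]] := derivation_on_generators _ _ charK0 DL.
have [a' [b' /= [_ _ D'5]]] := derivation_on_generators _ _ charK0 D'L.
move: meet; rewrite D'5 D2 => meet.
have a0 : a' = 0.
  by have := congr1 (coord 1) meet; expand; from_equation charK0 1%N.
have b0 : b' = 0.
  by have := congr1 (coord 5) meet; expand; from_equation charK0 1%N.
by rewrite meet a0 b0 !scale0r subrr (linear0l (@W2_mul K)).
Qed.

Lemma biderivation_eq0 (K : fieldType) (delta : W2 K -> W2 K -> W2 K) :
  [pchar K] =i pred0 -> is_biderivation (@W2_mul K) delta ->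
  forall x y, delta x y = 0.
Proof.
move=> charK0 [[lin_l lin_r] leib_l leib_r].
pose row_der x : {linear W2 K -> W2 K} :=
  HB.pack (delta x) (GRing.isLinear.Build _ _ _ _ (delta x) (lin_r x)).
pose col_der y : {linear W2 K -> W2 K} :=
  HB.pack (delta^~ y) (GRing.isLinear.Build _ _ _ _ (delta^~ y) (lin_l y)).
have row_leibniz x : leibniz (row_der x) by move=> y z; exact: leib_r.
have col_leibniz y : leibniz (col_der y) by move=> x z; exact: leib_l.
have d52 : delta (W2_e K 5) (W2_e K 2) = 0.
  exact: (derivations_meet_trivially K _ _ charK0 (row_leibniz _)
            (col_leibniz _) erefl).
have d5 y : delta (W2_e K 5) y = 0.
  exact: (derivation_eq0_of_e2 K _ charK0 (row_leibniz _) d52).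
move=> x y; exact: (derivation_eq0_of_e5 K _ charK0 (col_leibniz y) (d5 y)).
Qed.

Theorem theorem1p4 (K : fieldType) (charK0 : [pchar K] =i pred0) :
  (forall delta : W2 K -> W2 K -> W2 K,
     is_biderivation (@W2_mul K) delta <-> (forall x y : W2 K, delta x y = 0))
  /\ BDer (@W2_mul K) = [set (fun _ _ : W2 K => 0)]%classic.
Proof.
have zero_iff (delta : W2 K -> W2 K -> W2 K) :
    is_biderivation (@W2_mul K) delta <-> (forall x y : W2 K, delta x y = 0).
  split=> [|delta0]; first exact: biderivation_eq0.
  split=> [|x y z|x y z]; last 2 first.
  - by rewrite !delta0 (linear0r (@W2_mul K)) (linear0l (@W2_mul K)) addr0.
  - by rewrite !delta0 (linear0r (@W2_mul K)) (linear0l (@W2_mul K)) addr0.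
  by split=> u a v w; rewrite /= !delta0 scaler0 addr0.
split=> //; apply/seteqP; split=> delta /=.
- by move=> /zero_iff delta0; apply/funext=> x; apply/funext=> y; exact: delta0.
- by move=> ->; apply/zero_iff.
Qed.
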